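(* Let $M$ be an atomized semilattice over a finite set of constants $C=\{c_1,\dots,c_m\}$ and let $A=\{\phi_1,\dots,\phi_z\}$ be a non-empty set of atoms over $C$ of cardinality $z$ such that $\phi_i\ne\ominus_C$ for all $i$ and $M=[A\cup\{\ominus_C\}]$. Assume $M$ is not trivial, i.e. $M\ne[\ominus_C]$. For $j=1,\dots,z$ let $B_j=[\psi_{z_j},\psi_{z_j\overline z_j}]$ be the model over two constants $z_j,\overline z_j$ (all $2z$ constants being distinct) with $\mathbf{U}^c(\psi_{z_j})=\{z_j\}$ and $\mathbf{U}^c(\psi_{z_j\overline z_j})=\{z_j,\overline z_j\}$, so that $B_j\models(\overline z_j\lneq z_j)$; $B_j$ is equal to the homomorphic image of $M$ under the homomorphism $h_j$ given by $h_j(t)=z_j$ if $\phi_j<t$ and $h_j(t)=\overline z_j$ if $\phi_j\not<t$. Then: (i) $M$ is isomorphic to the subalgebra of $\bigotimes_{j=1}^zB_j$ generated by $u_{c_1},\dots,u_{c_m}$, where $u_{c_i}=(u_{i1},\dots,u_{iz})$ with $u_{ij}=z_j$ if $\phi_j<c_i$ and $u_{ij}=\overline z_j$ if $\phi_j\not<c_i$. (ii) $M$ is isomorphic to the subalgebra of $\bigoplus_{j=1}^zB_j$ generated by the terms $t_1,\dots,t_m$ over $\bigcup_{j=1}^z\{z_j,\overline z_j\}$ defined by: $z_k$ is a component constant of $t_i$ if and only if $\phi_k<c_i$, and $\overline z_k$ is a component constant of $t_i$ if and only if $\phi_k\not<c_i$.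
   Context: A semilattice is a nonempty set with a commutative, associative, idempotent operation $\odot$, ordered by $a\le b$ iff $a\odot b=b$. For a finite set $C$ of constants, $F_C(\emptyset)$ is the free semilattice on $C$; its elements (terms) $t$ are identified with their nonempty sets $\mathbf{C}(t)\subseteq C$ of component constants. A model over $C$ is a semilattice $M$ with a map $C\to M$ whose image generates $M$; it induces the natural homomorphism $\nu_M:F_C(\emptyset)\to M$. A positive duple is an inequality $t\le s$ between terms; a model satisfies it if $\nu_M(t)\le\nu_M(s)$. Models over the same constants are regarded as equal if they satisfy the same positive duples. An atom $\phi$ over $C$ is determined by a nonempty subset $\mathbf{U}^c(\phi)\subseteq C$; $\phi<t$ means $\mathbf{C}(t)\cap\mathbf{U}^c(\phi)\ne\emptyset$. A set $A$ of atoms over $C$ atomizes $M$ ($M=[A]$) if every $c\in C$ satisfies $\phi<c$ for some $\phi\in A$, and for all terms $t,s$: $\nu_M(t)\le\nu_M(s)$ iff there is no $\phi\in A$ with $\phi<t$, $\phi\not<s$. (If $\phi\in A$, whether $\phi<t$ depends only on the element $\nu_M(t)$.) $\ominus_C$ is the atom with $\mathbf{U}^c(\ominus_C)=C$. $\bigotimes_jB_j$ is the direct product of semilattices (componentwise operation). $\bigoplus_jB_j$ is the join model of the $B_j$: for models over pairwise disjoint sets of constants, it is the freest model over the union of the sets of constants (the one satisfying the fewest positive duples) into which each $B_j$ embeds by the map sending each constant to the constant of the same name. *)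

(* Defs.v *)
From HB Require Import structures.
From mathcomp Require Import all_boot all_order.

Set Implicit Arguments.
Unset Strict Implicit.
Unset Printing Implicit Defensive.

Import Order.TTheory.
Local Open Scope order_scope.

(* The semilattice operation is the join of a [joinSemilatticeType], so that  *)
(* a <= b iff [a `|` b = b].                                                  *)

(* The display only drives notations and carries no mathematical content; all *)
(* semilattices below share it so that they live in one type.                 *)
Fact slat_display : Order.disp_t. Proof. exact: Order.Disp tt tt. Qed.

Notation semilattice := (joinSemilatticeType slat_display).

Inductive generated (I : Type) (L : semilattice) (u : I -> L) : L -> Prop :=
  | generated_gen i : generated u (u i)
  | generated_join x y :
      generated u x -> generated u y -> generated u (x `|` y).

(* An element of the free semilattice on C, as its set of component constants. *)
Record term (C : finType) := Term {
  comps :> {set C};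
  comps_neq0 : comps != set0 }.
HB.instance Definition _ C := [isSub for @comps C].
HB.instance Definition _ C := [Finite of term C by <:].

Fact set1_neq0 (T : finType) (x : T) : [set x] != set0.
Proof. by apply/set0Pn; exists x; rewrite inE. Qed.

Definition cterm (C : finType) (c : C) : term C := @Term C [set c] (set1_neq0 c).

Record atom (C : finType) := Atom {
  upper :> {set C};
  upper_neq0 : upper != set0 }.
HB.instance Definition _ C := [isSub for @upper C].
HB.instance Definition _ C := [Finite of atom C by <:].

Definition atom_lt (C : finType) (phi : atom C) (t : term C) : bool :=
  comps t :&: upper phi != set0.

(* The atom \ominus_C, which exists only for nonempty C. *)
Definition ominus (C : finType) (hC : [set: C] != set0) : atom C := Atom hC.

Record model (C : finType) := Model {
  carrier :> semilattice;
  const : C -> carrier;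
  model_nonempty : inhabited carrier;
  model_generated : forall x : carrier, generated const x }.
Arguments const {C} m c.

(* The natural homomorphism nu_M.  Semilattices have no neutral element, so   *)
(* the iterated join over t is started at one of the components of t, which   *)
(* is harmless by idempotence; see [le_nu].                                   *)
Definition nu (C : finType) (M : model C) (t : term C) : M :=
  \big[Order.join/const M (xchoose (set0Pn _ (comps_neq0 t)))]_(c in comps t)
     const M c.

Lemma le_nu (C : finType) (M : model C) (t : term C) (y : M) :
  (nu M t <= y) = [forall c in comps t, const M c <= y].
Proof.
rewrite /nu; set x := xchoose _.
have xt : x \in comps t by exact: xchooseP.
apply/idP/forall_inP => [|tP].
  have: forall s, \big[Order.join/const M x]_(c <- s | c \in comps t) const M c <= y
     -> forall c, c \in s -> c \in comps t -> const M c <= y.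
    elim=> [//|a s IHs]; rewrite big_cons => + c.
    case: ifP => at_; rewrite ?leUx inE.
      by case/andP=> ay sy /predU1P[-> //|cs]; apply: IHs.
    by move=> sy /predU1P[->|cs]; [rewrite at_ | apply: IHs].
  by move=> H /H {}H c ct; apply: H; rewrite ?mem_index_enum.
elim/big_ind: _ => [|a b ay b_y|c ct]; last exact: tP; first exact: tP.
by rewrite leUx ay b_y.
Qed.

Definition satisfies (C : finType) (M : model C) (t s : term C) : Prop :=
  nu M t <= nu M s.

Definition atomizes (C : finType) (A : {set atom C}) (M : model C) : Prop :=
  (forall c : C, exists2 phi, phi \in A & atom_lt phi (cterm c)) /\
  (forall t s : term C, satisfies M t s <->
     ~ exists phi, [/\ phi \in A, atom_lt phi t & ~~ atom_lt phi s]).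

(* f is an isomorphism from M onto the subalgebra of L generated by the u c,  *)
(* the constant c being sent to the generator u c.                            *)
Definition iso_onto_generated (C : finType) (M : model C) (L : semilattice)
    (u : C -> L) (f : M -> L) : Prop :=
  [/\ {morph f : x y / x `|` y}, injective f,
      forall c, f (const M c) = u c &
      forall y, (exists x, f x = y) <-> generated u y].

Section DirectProduct.
Variables (I : finType) (L : I -> semilattice).

Definition direct_product := {dffun forall i, L i}.
HB.instance Definition _ := Choice.on direct_product.
Implicit Types f g h : direct_product.

Definition dp_tuple (u : forall i, L i) : direct_product := finfun u.

Definition dp_le f g := [forall i, f i <= g i].
Definition dp_join f g : direct_product := dp_tuple (fun i => f i `|` g i).

Fact dp_le_refl : reflexive dp_le.
Proof. by move=> f; apply/forallP. Qed.

Fact dp_le_anti : antisymmetric dp_le.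
Proof.
move=> f g /andP[/forallP fg /forallP gf]; apply/ffunP => i.
by apply: le_anti; rewrite fg gf.
Qed.

Fact dp_le_trans : transitive dp_le.
Proof.
move=> g f h /forallP fg /forallP gh; apply/forallP => i.
exact: le_trans (fg i) (gh i).
Qed.

HB.instance Definition _ := Order.Le_isPOrder.Build slat_display direct_product
  dp_le_refl dp_le_anti dp_le_trans.

Fact dp_leUx f g h : (dp_join f g <= h) = (f <= h) && (g <= h).
Proof.
apply/forallP/andP => [H|[/forallP fh /forallP gh] i]; last first.
  by rewrite ffunE leUx fh gh.
by split; apply/forallP => i; have := H i; rewrite ffunE leUx => /andP[].
Qed.

HB.instance Definition _ :=
  Order.POrder_isJoinSemilattice.Build slat_display direct_product dp_leUx.

Lemma direct_productE f g i : (f `|` g) i = f i `|` g i.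
Proof. by rewrite [f `|` g]/Order.join /= ffunE. Qed.

End DirectProduct.

(* For a family of models over pairwise disjoint sets of constants K i, the   *)
(* union of these sets is the tagged union {i : I & K i}, in which the        *)
(* constant k : K i is called [Tagged K k].                                   *)
Definition embeds (I : finType) (K : I -> finType) (i : I) (B : model (K i))
    (N : model {i : I & K i}) : Prop :=
  exists f : B -> N, [/\ {morph f : x y / x `|` y}, injective f &
    forall k : K i, f (const B k) = const N (Tagged K k)].

Definition is_join_model (I : finType) (K : I -> finType)
    (B : forall i, model (K i)) (J : model {i : I & K i}) : Prop :=
  (forall i, embeds (B i) J) /\
  (forall N : model {i : I & K i}, (forall i, embeds (B i) N) ->
     forall t s, satisfies J t s -> satisfies N t s).

(* The two constants z_j and \overline z_j of B_j; across different j they    *)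
(* are kept distinct by the tag j in the join model.                          *)
Definition zz : bool := true.
Definition zbar : bool := false.

Fact zz_zbar_neq0 : [set zz; zbar] != set0.
Proof. by apply/set0Pn; exists zz; rewrite !inE. Qed.

Definition psi_z : atom bool := @Atom bool [set zz] (set1_neq0 zz).
Definition psi_zzbar : atom bool := @Atom bool [set zz; zbar] zz_zbar_neq0.

(* The model whose positive duples t <= s are given by inclusion of t in the  *)
(* closure of s, for a closure operator on sets of constants.                 *)
Section ClosureModel.
Variables (K : finType) (cl : {set K} -> {set K}) (k0 : K).
Hypothesis clE : forall S : {set K}, S \subset cl S.
Hypothesis clS : forall S T : {set K}, S \subset T -> cl S \subset cl T.
Hypothesis clK : forall S : {set K}, cl (cl S) \subset cl S.

Record closed := Closed {
  cset :> {set K};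
  csetP : (cset != set0) && (cl cset \subset cset) }.
HB.instance Definition _ := [isSub for cset].
HB.instance Definition _ := [Choice of closed by <:].
Implicit Types x y w : closed.

Fact cl_closed (S : {set K}) : S != set0 -> (cl S != set0) && (cl (cl S) \subset cl S).
Proof.
by move=> S0; rewrite clK andbT; apply: subset_neq0 S0; apply: clE.
Qed.

Fact cl_sub (S : {set K}) y : (cl S \subset cset y) = (S \subset cset y).
Proof.
have /andP[_ yP] := csetP y.
by apply/idP/idP => [|/clS /subset_trans]; [apply: subset_trans | apply].
Qed.

Definition closed_le x y := cset x \subset cset y.

Fact closed_le_refl : reflexive closed_le. Proof. by move=> x; apply: subxx. Qed.
Fact closed_le_anti : antisymmetric closed_le.
Proof. by move=> x y xy; apply/val_inj/eqP; rewrite eqEsubset. Qed.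
Fact closed_le_trans : transitive closed_le.
Proof. by move=> y x w; apply: subset_trans. Qed.
HB.instance Definition _ := Order.Le_isPOrder.Build slat_display closed
  closed_le_refl closed_le_anti closed_le_trans.

Fact setU_closed_neq0 x y : cset x :|: cset y != set0.
Proof. by have /andP[x0 _] := csetP x; apply: subset_neq0 x0; apply: subsetUl. Qed.

Definition closed_join x y := Closed (cl_closed (setU_closed_neq0 x y)).

Fact closed_leUx x y w : (closed_join x y <= w) = (x <= w) && (y <= w).
Proof. by rewrite /Order.le /= /closed_le /= cl_sub subUset. Qed.
HB.instance Definition _ :=
  Order.POrder_isJoinSemilattice.Build slat_display closed closed_leUx.

Definition closed_const k := Closed (cl_closed (set1_neq0 k)).

Fact closed_generated x : generated closed_const x.
Proof.
have /andP[x0 _] := csetP x.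
have [k kx] := set0Pn _ x0.
pose y := \big[Order.join/closed_const k]_(c in cset x) closed_const c.
have <- : y = x.
  apply: le_anti; apply/andP; split.
    rewrite /y; elim/big_ind: _ => [|a b ax bx|c cx].
    - by rewrite /Order.le /= /closed_le /= cl_sub sub1set.
    - by rewrite leUx ax.
    - by rewrite /Order.le /= /closed_le /= cl_sub sub1set.
  rewrite /Order.le /= /closed_le; apply/subsetP => c cx.
  have : closed_const c <= y.
    rewrite /y; have: c \in index_enum K by exact: mem_index_enum.
    elim: (index_enum K) => // a s IHs; rewrite big_cons inE.
    case/predU1P => [<-|/IHs {}IHs]; first by rewrite cx leUl.
    by case: ifP => // _; apply: le_trans IHs (leUr _ _).
  by rewrite /Order.le /= /closed_le /= cl_sub sub1set.
rewrite /y; elim/big_ind: _ => [|a b|c _].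
- exact: generated_gen.
- exact: generated_join.
- exact: generated_gen.
Qed.

Definition closure_model : model K :=
  Model (inhabits (closed_const k0)) closed_generated.

Lemma nu_closure_model (t : term K) : cset (nu closure_model t) = cl (comps t).
Proof.
pose w : closure_model := Closed (cl_closed (comps_neq0 t)).
suff -> : nu closure_model t = w by [].
apply: le_anti; apply/andP; split.
  rewrite le_nu; apply/forall_inP => c ct.
  by rewrite /Order.le /= /closed_le /= clS ?sub1set.
rewrite /Order.le /= /closed_le cl_sub; apply/subsetP => c ct.
have := lexx (nu closure_model t).
rewrite {1}le_nu => /forall_inP/(_ c ct).
by rewrite /Order.le /= /closed_le /= cl_sub sub1set.
Qed.

Lemma satisfies_closure_model t s :
  satisfies closure_model t s <-> comps t \subset cl (comps s).
Proof.
rewrite /satisfies /Order.le /= /closed_le (nu_closure_model t) cl_sub.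
by rewrite nu_closure_model.
Qed.

End ClosureModel.

(* Hence [A] exists for every set A of atoms covering the constants.          *)
Lemma atomized_model_exists (C : finType) (hC : [set: C] != set0)
    (A : {set atom C}) :
    (forall c : C, exists2 phi, phi \in A & atom_lt phi (cterm c)) ->
  exists M, atomizes A M.
Proof.
move=> Acov; have [c0 _] := set0Pn _ hC.
pose cl (S : {set C}) := [set c | [forall phi in A,
  (c \in upper phi) ==> (S :&: upper phi != set0)]].
have clE (S : {set _}) : S \subset cl S.
  apply/subsetP => c cS; rewrite inE; apply/forall_inP => phi _.
  by apply/implyP => c_phi; apply/set0Pn; exists c; rewrite inE cS.
have clS (S T : {set _}) : S \subset T -> cl S \subset cl T.
  move=> ST; apply/subsetP => c; rewrite !inE => /forall_inP H.
  apply/forall_inP => phi pA; apply/implyP => cp.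
  have := implyP (H _ pA) cp; apply: subset_neq0.
  exact: setSI.
have clK (S : {set _}) : cl (cl S) \subset cl S.
  apply/subsetP => c; rewrite inE [in X in _ -> X]inE => /forall_inP H.
  apply/forall_inP => phi pA; apply/implyP => cp.
  have /set0Pn[d] := implyP (H _ pA) cp; rewrite !inE.
  by case/andP => /forall_inP/(_ _ pA)/implyP.
exists (closure_model c0 clE clS clK); split=> // t s.
apply: iff_trans (satisfies_closure_model _ _ _ _ _ _) _.
split=> [ts [phi [pA pt ps]]|H].
  case/set0Pn: pt => c; rewrite inE => /andP[ct cp].
  have := subsetP ts c ct; rewrite inE => /forall_inP/(_ _ pA)/implyP/(_ cp).
  by move: ps; rewrite /atom_lt => /negP.
apply/subsetP => c ct; rewrite inE; apply/forall_inP => phi pA.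
apply/implyP => cp; apply: contra_notT H => ps; exists phi; split=> //.
by apply/set0Pn; exists c; rewrite inE ct.
Qed.

Lemma const_le_nu (C : finType) (M : model C) (t : term C) c :
  c \in comps t -> const M c <= nu M t.
Proof. by move=> ct; have := lexx (nu M t); rewrite {1}le_nu => /forall_inP; apply. Qed.

Lemma morph_nu (C : finType) (M : model C) (L : semilattice) (f : M -> L)
    (t : term C) (y : L) : {morph f : a b / a `|` b} ->
  (f (nu M t) <= y) = [forall c in comps t, f (const M c) <= y].
Proof.
move=> fU; apply/idP/forall_inP => [H c ct|H].
  apply: le_trans H; rewrite leEjoin -fU; apply/eqP; congr f.
  by rewrite (join_r (const_le_nu M ct)).
rewrite /nu; set x := xchoose _.
have xt : x \in comps t by exact: xchooseP.
elim/big_ind: _ => [|a b ay b_y|c ct]; [exact: H | | exact: H].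
by rewrite fU leUx ay b_y.
Qed.

Lemma nu_surj (C : finType) (M : model C) (x : M) : exists t, x = nu M t.
Proof.
elim: (model_generated x) => [c|_ _ _ [t ->] _ [s ->]].
  exists (cterm c); apply: le_anti; rewrite const_le_nu ?inE //= le_nu.
  by apply/forall_inP => d /set1P->.
have ts0 : comps t :|: comps s != set0.
  by apply: subset_neq0 (comps_neq0 t); apply: subsetUl.
exists (@Term C _ ts0); apply: le_anti; rewrite leUx !le_nu /=.
apply/andP; split; last first.
  apply/forall_inP => c; rewrite inE => /orP[] ct.
    by apply: le_trans (leUl _ _); apply: const_le_nu.
  by apply: le_trans (leUr _ _); apply: const_le_nu.
by apply/andP; split; apply/forall_inP => c ct; apply: const_le_nu;
  rewrite /= inE ct ?orbT.
Qed.

(* The join model exists; it is unique up to the positive duples satisfied.   *)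
Lemma join_model_exists (I : finType) (K : I -> finType)
    (B : forall i, model (K i)) (i0 : I) : exists J, is_join_model B J.
Proof.
have [x0] := model_nonempty (B i0); have [t0 _] := nu_surj x0.
have [k0 _] := set0Pn _ (comps_neq0 t0).
pose fib (S : {set {i : I & K i}}) i := [set k : K i | Tagged K k \in S].
pose cl S := [set p : {i : I & K i} | [exists t : term (K (tag p)),
  (comps t \subset fib S (tag p)) && (const (B _) (tagged p) <= nu (B _) t)]].
have clP (S : {set _}) i (k : K i) : reflect (exists2 t, comps t \subset fib S i &
    const (B i) k <= nu (B i) t) (Tagged K k \in cl S).
  rewrite inE /=; apply: (iffP existsP) => [[t /andP[]]|[t ? ?]]; exists t => //.
  exact/andP.
have clE (S : {set _}) : S \subset cl S.
  apply/subsetP => -[i k] kS; apply/clP; exists (cterm k).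
    by rewrite sub1set inE.
  by rewrite const_le_nu ?inE.
have clS (S T : {set _}) : S \subset T -> cl S \subset cl T.
  move=> ST; apply/subsetP => -[i k] /clP[t tS kt]; apply/clP; exists t => //.
  by apply: subset_trans tS _; apply/subsetP => d; rewrite !inE; apply: (subsetP ST).
have clK (S : {set _}) : cl (cl S) \subset cl S.
  apply/subsetP => -[i k] /clP[t tS kt]; apply/clP.
  have [d dt] := set0Pn _ (comps_neq0 t).
  have: d \in fib (cl S) i by apply: (subsetP tS).
  rewrite inE => /clP[s sS ds].
  have S0 : fib S i != set0 by apply: subset_neq0 sS (comps_neq0 s).
  exists (@Term _ _ S0) => //; apply: le_trans kt _; rewrite le_nu.
  apply/forall_inP => e et.
  have: e \in fib (cl S) i by apply: (subsetP tS).
  rewrite inE => /clP[r rS /le_trans]; apply.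
  by rewrite le_nu; apply/forall_inP => a /(subsetP rS) aS; apply: const_le_nu.
pose J := closure_model (Tagged K k0) clE clS clK.
exists J; split=> [i|N embN t s].
  have im0 (x : B i) : [set p : {i : I & K i} | [exists k : K i,
     (p == Tagged K k) && (const (B i) k <= x)]] != set0.
    have [t ->] := nu_surj x; have [k kt] := set0Pn _ (comps_neq0 t).
    apply/set0Pn; exists (Tagged K k); rewrite inE; apply/existsP; exists k.
    by rewrite eqxx const_le_nu.
  have imP (x : B i) (k : K i) :
     (Tagged K k \in comps (@Term _ _ (im0 x))) = (const (B i) k <= x).
    rewrite inE; apply/existsP/idP => [[l /andP[/eqP/eqP]]|kx].
      by rewrite eq_Tagged /= => /eqP->.
    by exists k; rewrite eqxx.
  have im_sub (x : B i) (T : {set {i : I & K i}}) :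
      comps (@Term _ _ (im0 x)) \subset T =
      [forall k : K i, (const (B i) k <= x) ==> (Tagged K k \in T)].
    apply/subsetP/forallP => [H k|H [j k]].
      by apply/implyP => kx; apply: H; rewrite imP.
    rewrite inE => /existsP[l /andP[/eqP-> lx]].
    exact: (implyP (H l)).
  pose f x : J := nu J (Term (im0 x)).
  have fle (x y : B i) : (f x <= f y) = (x <= y).
    have -> : (f x <= f y) =
        (comps (Term (im0 x)) \subset cl (comps (Term (im0 y)))).
      by apply/idP/idP => /(satisfies_closure_model (Tagged K k0) clE clS clK).
    rewrite im_sub; apply/forallP/idP => [H|xy k].
      have [t tE] := nu_surj x; rewrite [in X in X <= _]tE le_nu.
      apply/forall_inP => k kt.
      have: const (B i) k <= x by rewrite tE const_le_nu.
      move/(implyP (H k))/clP => [s /subsetP sy /le_trans]; apply.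
      by rewrite le_nu; apply/forall_inP => l /sy; rewrite inE imP.
    apply/implyP => kx; apply: (subsetP (clE _)); rewrite imP.
    exact: le_trans kx xy.
  have fconst (k : K i) : f (const (B i) k) = const J (Tagged K k).
    have kk : Tagged K k \in cl [set Tagged K k].
      by apply: (subsetP (clE _)); rewrite inE.
    suff H : cl (comps (Term (im0 (const (B i) k)))) = cl [set Tagged K k].
      by apply: val_inj; apply: etrans (nu_closure_model _ _ _ _ _) H.
    apply/eqP; rewrite eqEsubset; apply/andP; split.
      apply: subset_trans (clK _); apply: (clS).
      rewrite im_sub; apply/forallP => l; apply/implyP => lk; apply/clP.
      exists (cterm k); first by rewrite sub1set !inE.
      by apply: le_trans lk _; apply: const_le_nu; rewrite inE.
    by apply: (clS); rewrite sub1set imP.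
  exists f; split=> //.
    move=> x y; apply: le_anti; rewrite leUx !fle leUl leUr !andbT.
    have [tx xE] := nu_surj x; have [ty yE] := nu_surj y.
    rewrite {1}/f le_nu; apply/forall_inP => -[j k].
    rewrite inE => /existsP[l /andP[/eqP-> lxy]].
    rewrite -fconst.
    have ts0 : comps tx :|: comps ty != set0.
      by apply: subset_neq0 (comps_neq0 tx); apply: subsetUl.
    pose w := @Term _ _ ts0.
    have lw : const (B i) l <= nu (B i) w.
      apply: le_trans lxy _; rewrite leUx xE yE !le_nu; apply/andP; split;
      by apply/forall_inP => c ct; apply: const_le_nu; rewrite inE ct ?orbT.
    pose g : J := f x `|` f y.
    have : const J (Tagged K l) <= g.
      have wg c : c \in comps w -> Tagged K c \in cset g.
        move=> cw.
        have : const J (Tagged K c) <= g.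
          rewrite -fconst; case/setUP: cw => ct.
            by apply: le_trans (leUl _ _); rewrite fle xE const_le_nu.
          by apply: le_trans (leUr _ _); rewrite fle yE const_le_nu.
        by move/subsetP; apply; apply: (subsetP (clE _)); rewrite inE.
      have /andP[_ /subsetP gP] := csetP g.
      have lg : Tagged K l \in cset g.
        apply: gP; apply/clP; exists w => //.
        by apply/subsetP => c /wg cg; rewrite inE.
      have: cl [set Tagged K l] \subset cset g by rewrite (cl_sub clE clS) sub1set.
      by [].
    by rewrite fconst.
  by move=> x y fxy; apply: le_anti; rewrite -!fle fxy lexx.
move/satisfies_closure_model/subsetP => ts; rewrite /satisfies le_nu.
apply/forall_inP => -[i k] /ts /clP[r /subsetP rs kr].
have [f [fU _ fc]] := embN i.
rewrite -[existT _ _ _]/(Tagged K k) -fc.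
apply: (@le_trans _ _ (f (nu (B i) r))).
  by rewrite leEjoin -fU (join_r kr).
rewrite (morph_nu _ _ fU); apply/forall_inP => c /rs; rewrite inE => cs.
by rewrite fc const_le_nu.
Qed.

(* Main.v *)
(* As \ominus_C lies below every term, t <= s holds in M iff                  *)
(* every phi_j below t is below s.  So t |-> (h_j(t))_j preserves and reflects *)
(* the order of M, which gives (i).  For (ii), the embeddings of the B_j force *)
(* \overline z_j <= z_j in the join model, so that the order of M is           *)
(* preserved.  It is reflected because z_j is below a term of the join model   *)
(* only if it is one of its components: this can be tested in any model into   *)
(* which all the B_j embed, and we take the one whose only relations are       *)
(* \overline z_j <= z_j.                                                       *)
Require Import Defs.
From HB Require Import structures.
From mathcomp Require Import all_boot all_order.

Set Implicit Arguments.
Unset Strict Implicit.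
Unset Printing Implicit Defensive.

Import Order.TTheory.
Local Open Scope order_scope.

(** A map on terms that turns unions of components into joins descends to a homomorphism on $M$ when
    it respects the positive duples of $M$ ([model_lift]), and to an embedding when it also reflects
    them ([model_embed]). Three such maps are used: $t\mapsto h_j(t)$, the tuple of all $h_j(t)$,
    and the substitution of the terms $t_i$ for the constants $c_i$. It remains to compare orders.
    In $M$ only the $\phi_j$ can separate two terms; in $B_j$ only $z_j$ matters ([satisfies_two]);
    in the join model a positive duple can fail only through some constant that is neither a
    component of the right side nor a $\overline z_j$ with $z_j$ there ([satisfies_join]). *)

Lemma eq_from_le (L : semilattice) (a b : L) :
  (forall y, (a <= y) = (b <= y)) -> a = b.
Proof. by move=> H; apply: le_anti; rewrite H lexx -H lexx. Qed.

Lemma nu_cterm (C : finType) (M : model C) (c : C) : nu M (cterm c) = const M c.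
Proof.
apply: eq_from_le => y; rewrite le_nu; apply/forall_inP/idP => [|cy d].
  by apply; rewrite inE.
by move/set1P->.
Qed.

Lemma atom_lt_cterm (C : finType) (phi : atom C) (c : C) :
  atom_lt phi (cterm c) = (c \in upper phi).
Proof.
apply/set0Pn/idP => [[d]|cphi]; first by rewrite inE => /andP[/set1P->].
by exists c; rewrite !inE eqxx.
Qed.

Lemma atom_ltP (C : finType) (phi : atom C) (t : term C) :
  reflect (exists2 c, c \in comps t & atom_lt phi (cterm c)) (atom_lt phi t).
Proof.
apply: (iffP (set0Pn _)) => [[c]|[c ct]].
  by rewrite inE => /andP[ct cphi]; exists c; rewrite ?atom_lt_cterm.
by rewrite atom_lt_cterm => cphi; exists c; rewrite inE ct.
Qed.

Fact bigcup_neq0 (C K : finType) (t : term C) (T : C -> term K) :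
  \bigcup_(c in comps t) comps (T c) != set0.
Proof.
have [c ct] := set0Pn _ (comps_neq0 t).
by apply: subset_neq0 (comps_neq0 (T c)); apply: (bigcup_sup c).
Qed.

(** Substitution of [T] for the constants: the homomorphism of free semilattices extending [T]. *)
Definition term_bind (C K : finType) (T : C -> term K) (t : term C) : term K :=
  Term (bigcup_neq0 t T).

Lemma nu_term_bind_le (C K : finType) (N : model K) (T : C -> term K)
    (t : term C) (y : N) :
  (nu N (term_bind T t) <= y) = [forall c in comps t, nu N (T c) <= y].
Proof.
rewrite le_nu; apply/forall_inP/forall_inP => [H c ct|H k].
  rewrite le_nu; apply/forall_inP => k kT; apply: H.
  by apply/bigcupP; exists c.
by case/bigcupP => c /H + kT; apply: le_trans; apply: const_le_nu.
Qed.

Section Lift.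
Variables (C : finType) (M : model C) (L : semilattice).
Variables (u : C -> L) (g : term C -> L).
Hypothesis gP : forall t y, (g t <= y) = [forall c in comps t, u c <= y].
Hypothesis g_mono : forall t s, satisfies M t s -> g t <= g s.

(** [gP] makes [g t] the supremum of the [u c] over the components of [t], stated through upper
    bounds. By [g_mono], [g] takes the same value on all terms naming the same element of [M], so
    [f] can be computed on any chosen representative. *)
Lemma model_lift : exists f : M -> L,
  [/\ {morph f : x y / x `|` y}, forall t, f (nu M t) = g t,
      forall c, f (const M c) = u c &
      forall y, (exists x, f x = y) <-> generated u y].
Proof.
have ex x : exists t, x == nu M t by have [t ->] := nu_surj x; exists t.
pose f x := g (xchoose (ex x)).
have f_nu t : f (nu M t) = g t.
  have /eqP E := xchooseP (ex (nu M t)).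
  by apply: le_anti; rewrite /f !g_mono // /satisfies -E.
have g_cterm c : g (cterm c) = u c.
  apply: eq_from_le => y; rewrite gP; apply/forall_inP/idP => [|cy d].
    by apply; rewrite inE.
  by move/set1P->.
have f_const c : f (const M c) = u c by rewrite -nu_cterm f_nu g_cterm.
have fU : {morph f : x y / x `|` y}.
  move=> x y; have [t ->] := nu_surj x; have [s ->] := nu_surj y.
  have ts0 : comps t :|: comps s != set0.
    by apply: subset_neq0 (comps_neq0 t); apply: subsetUl.
  have forallU (P : pred C) : [forall c in comps t :|: comps s, P c] =
      [forall c in comps t, P c] && [forall c in comps s, P c].
    apply/forall_inP/andP => [H|[/forall_inP Pt /forall_inP Ps] c].
      by split; apply/forall_inP => c ct; apply: H; rewrite inE ct ?orbT.
    by case/setUP => [/Pt|/Ps].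
  have -> : nu M t `|` nu M s = nu M (Term ts0).
    by apply: eq_from_le => w; rewrite leUx !le_nu forallU.
  by rewrite !f_nu; apply: eq_from_le => w; rewrite leUx !gP forallU.
exists f; split=> // y; split=> [[x <-]|].
  elim: (model_generated x) => [c|a b _ ga _ gb].
    by rewrite f_const; apply: generated_gen.
  by rewrite fU; apply: generated_join.
elim=> [c|_ _ _ [a <-] _ [b <-]]; first by exists (const M c).
by exists (a `|` b).
Qed.

Lemma model_embed : (forall t s, g t <= g s -> satisfies M t s) ->
  exists f : M -> L, iso_onto_generated u f.
Proof.
move=> g_refl; have [f [fU f_nu f_const f_gen]] := model_lift.
exists f; split=> // x y.
have [t ->] := nu_surj x; have [s ->] := nu_surj y.
by rewrite !f_nu => gts; apply: le_anti; rewrite !g_refl // gts.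
Qed.

End Lift.

(** This is why each $h_j$ preserves joins: [hi] is reached as soon as one component lies above
    [phi]; otherwise [lo] is reached, since [t] has some component. *)
Lemma atom_sup (C : finType) (L : semilattice) (lo hi : L) (phi : atom C)
    (t : term C) (y : L) : lo <= hi ->
  ((if atom_lt phi t then hi else lo) <= y) =
  [forall c in comps t, (if atom_lt phi (cterm c) then hi else lo) <= y].
Proof.
move=> lo_hi; apply/idP/forall_inP => [ty c ct|H].
  case: ifP => [cphi|_].
    by move: ty; rewrite ifT //; apply/atom_ltP; exists c.
  by apply: le_trans ty; case: ifP.
case: ifP => [/atom_ltP[c ct cphi]|/negP tphi].
  by have := H c ct; rewrite cphi.
have [c ct] := set0Pn _ (comps_neq0 t); apply: le_trans (H c ct).
by case: ifP.
Qed.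

Section TwoElementModel.
Variable B : model bool.
Hypothesis hB : atomizes [set psi_z; psi_zzbar] B.

(** [psi_zzbar] lies below every term, so only [psi_z] can separate two terms. *)
Lemma satisfies_two t s :
  satisfies B t s <-> (zz \in comps t -> zz \in comps s).
Proof.
have psi_zE r : atom_lt psi_z r = (zz \in comps r).
  apply/atom_ltP/idP => [[c cr]|zr].
    by rewrite atom_lt_cterm => /set1P <-.
  by exists zz; rewrite ?atom_lt_cterm ?inE.
have psi_zzbarT r : atom_lt psi_zzbar r.
  have [c cr] := set0Pn _ (comps_neq0 r).
  by apply/atom_ltP; exists c; rewrite // atom_lt_cterm !inE; case: (c).
apply: iff_trans (hB.2 t s) _; split=> [H zt|H [psi [/set2P[]-> pt ps]]].
- apply/negPn/negP => zs; apply: H; exists psi_z.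
  by rewrite set21 !psi_zE.
- by move: ps; rewrite psi_zE H // -psi_zE.
- by rewrite psi_zzbarT in ps.
Qed.

Lemma zbar_le_zz : const B zbar <= const B zz.
Proof. by rewrite -!nu_cterm; apply/satisfies_two; rewrite !inE. Qed.

Lemma zz_nle_zbar : ~ const B zz <= const B zbar.
Proof. by rewrite -!nu_cterm => /satisfies_two; rewrite !inE => /(_ isT). Qed.

Lemma twoP (y : B) : y = const B zz \/ y = const B zbar.
Proof.
have [t ->] := nu_surj y; rewrite -!nu_cterm.
have [zt|zt] := boolP (zz \in comps t); [left|right]; apply: le_anti;
  by apply/andP; split; apply/satisfies_two; rewrite ?zt ?(negbTE zt) !inE.
Qed.

End TwoElementModel.

Section JoinOfTwoElementModels.
Variables (I : finType) (B : I -> model bool).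
Hypothesis hB : forall i, atomizes [set psi_z; psi_zzbar] (B i).
Local Notation K := {i : I & bool}.
Local Notation tagc i b := (existT (fun=> bool) i b).

(** Closure under the sole relations $\overline z_i\le z_i$; its closure model is the test model. *)
Let cl (S : {set K}) : {set K} :=
  [set p | (p \in S) || (tagc (tag p) zz \in S)].

Let clE (S : {set K}) : S \subset cl S.
Proof. by apply/subsetP => p; rewrite inE => ->. Qed.

Let clS (S T : {set K}) : S \subset T -> cl S \subset cl T.
Proof.
by move=> /subsetP ST; apply/subsetP => p; rewrite !inE => /orP[] /ST ->;
  rewrite ?orbT.
Qed.

Let clK (S : {set K}) : cl (cl S) \subset cl S.
Proof. by apply/subsetP => p; rewrite !inE /= orbb -orbA orbb. Qed.

(** Renaming [b] to [tagc i b] preserves and reflects the order, because the relations of the test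
    model within the tag [i] are those of [B i]. The index [i0] only supplies a constant. *)
Let embeds_closure_model (i0 i : I) :
  @embeds I (fun=> bool) i (B i) (closure_model (tagc i0 zz) clE clS clK).
Proof.
set N := closure_model _ _ _ _.
pose T b := cterm (tagc i b).
have in_bind (t : term bool) j b :
    (tagc j b \in comps (term_bind T t)) = (j == i) && (b \in comps t).
  apply/bigcupP/andP => [[d dt /set1P E]|[/eqP-> bt]]; last first.
    by exists b; rewrite ?inE.
  by case: E dt => -> ->.
have satE t s :
    satisfies N (term_bind T t) (term_bind T s) <-> satisfies (B i) t s.
  apply: (iff_trans (satisfies_closure_model _ clE clS clK _ _)).
  apply: (iff_trans _ (iff_sym (satisfies_two (hB i) t s))).
  split=> [/subsetP H zt|H].
    have := H (tagc i zz); rewrite inE !in_bind eqxx /= orbb.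
    exact.
  apply/subsetP => -[j b]; rewrite inE !in_bind => /andP[/eqP-> bt].
  rewrite eqxx /=; case: b bt => [/H->//|_].
  (* For $\overline z_i$ any component of [s] will do, be it $z_i$ or $\overline z_i$. *)
  have [[] bs] := set0Pn _ (comps_neq0 s); first by rewrite [true \in _]bs orbT.
  by rewrite [false \in _]bs.
have [] := @model_embed _ (B i) N (fun b => const N (tagc i b))
  (fun t => nu N (term_bind T t)).
- move=> t y; rewrite nu_term_bind_le.
  by apply: eq_forallb_in => b _; rewrite nu_cterm.
- by move=> t s /satE.
- by move=> t s /satE.
by move=> f [fU finj fc _]; exists f.
Qed.

Variable J : model K.
Hypothesis hJ : is_join_model B J.

Lemma join_zbar_le_zz i : const J (tagc i zbar) <= const J (tagc i zz).
Proof.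
have [f [fU _ fc]] := hJ.1 i.
have := fc zz; rewrite /Tagged => <-; have := fc zbar; rewrite /Tagged => <-.
by rewrite leEjoin -fU join_r ?zbar_le_zz.
Qed.

(** The forward direction tests [J], the freest model, against the closure model. For [p] with
    second part [zz] both alternatives coincide, so $z_i$ must itself be a component of [s]. *)
Lemma satisfies_join (t s : term K) : satisfies J t s <->
  forall p, p \in comps t -> (p \in comps s) || (tagc (tag p) zz \in comps s).
Proof.
split=> [Jts [i b] ibt|H].
  have /(satisfies_closure_model (tagc i zz) clE clS clK)/subsetP :=
    hJ.2 _ (embeds_closure_model i) _ _ Jts.
  by move/(_ _ ibt); rewrite inE.
rewrite /satisfies le_nu; apply/forall_inP => -[i b] /H.
case/orP => [|/= zs]; first exact: const_le_nu.
apply: le_trans (const_le_nu J zs).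
by case: b; rewrite ?lexx ?join_zbar_le_zz.
Qed.

End JoinOfTwoElementModels.

Theorem theorem37 (C : finType) (hC : [set: C] != set0) (M : model C)
    (A : {set atom C}) (z : nat) (phi : 'I_z -> atom C)
    (hA0 : A != set0) (hAz : #|A| = z) (hA : A = [set phi j | j : 'I_z])
    (hphi : forall j, phi j <> ominus hC)
    (hM : atomizes (A :|: [set ominus hC]) M)
    (hMnt : ~ atomizes [set ominus hC] M)
    (B : 'I_z -> model bool)
    (hB : forall j, atomizes [set psi_z; psi_zzbar] (B j)) :
  (forall j,
     (satisfies (B j) (cterm zbar) (cterm zz) /\
      ~ satisfies (B j) (cterm zz) (cterm zbar)) /\
     exists h : M -> B j,
       [/\ {morph h : x y / x `|` y},
           forall t : term C, h (nu M t) =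
             if atom_lt (phi j) t then const (B j) zz else const (B j) zbar &
           forall y : B j, exists x : M, h x = y]) /\
  (exists f : M -> direct_product B,
     iso_onto_generated
       (fun c : C => dp_tuple (fun j : 'I_z =>
          if atom_lt (phi j) (cterm c)
          then const (B j) zz else const (B j) zbar)) f) /\
  (forall (J : model {j : 'I_z & bool}) (t : C -> term {j : 'I_z & bool}),
     is_join_model B J ->
     (forall (c : C) (k : 'I_z),
        (existT (fun=> bool) k zz \in comps (t c))
          = atom_lt (phi k) (cterm c)) ->
     (forall (c : C) (k : 'I_z),
        (existT (fun=> bool) k zbar \in comps (t c))
          = ~~ atom_lt (phi k) (cterm c)) ->
     exists f : M -> J, iso_onto_generated (fun c : C => nu J (t c)) f).
Proof.
have satM t s : satisfies M t s <->
    forall j, atom_lt (phi j) t -> atom_lt (phi j) s.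
  apply: iff_trans (hM.2 t s) _; split=> [H j jt|H [psi [/setUP[]]]].
  - apply: contraT => js; case: H; exists (phi j).
    by rewrite inE hA imset_f ?inE ?orbT.
  - by rewrite hA => /imsetP[j _ ->] /H js /negP.
  - move/set1P-> => _ /negP[]; have [c cs] := set0Pn _ (comps_neq0 s).
    by apply/atom_ltP; exists c; rewrite // atom_lt_cterm inE.
pose g j (t : term C) :=
  if atom_lt (phi j) t then const (B j) zz else const (B j) zbar.
have gP j t y : (g j t <= y) = [forall c in comps t, g j (cterm c) <= y].
  exact: atom_sup (zbar_le_zz (hB j)).
have g_mono t s : satisfies M t s -> forall j, g j t <= g j s.
  move=> /satM + j => /(_ j); rewrite /g.
  case: ifP => [_ ts|_ _]; first by rewrite ts.
  by case: ifP => // _; exact: zbar_le_zz.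
have g_refl t s : (forall j, g j t <= g j s) -> satisfies M t s.
  move=> gts; apply/satM => j jt; have := gts j; rewrite /g jt.
  by case: ifP => // _ /(zz_nle_zbar (hB j)).
split; [|split] => [j||J T hJ Tzz Tzbar].
- rewrite /satisfies !nu_cterm; split.
    by split; [apply: zbar_le_zz | apply: zz_nle_zbar].
  have [h [hU h_nu _ _]] := model_lift (gP j) (fun t s ts => g_mono t s ts j).
  exists h; split=> // y; have [->|->] := twoP (hB j) y.
    have [c cj] := set0Pn _ (upper_neq0 (phi j)).
    by exists (nu M (cterm c)); rewrite h_nu /g atom_lt_cterm cj.
  (* The value $\overline z_j$ is attained because $\phi_j\ne\ominus_C$ misses some constant. *)
  have [c cj] : exists c, c \notin upper (phi j).
    apply/existsP; rewrite -negb_forall; apply/negP => /forallP all_c.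
    by apply: (hphi j); apply/val_inj/setP => c; rewrite /= all_c inE.
  by exists (nu M (cterm c)); rewrite h_nu /g atom_lt_cterm (negbTE cj).
- have dp_leE (a b : forall j, B j) :
      (dp_tuple a <= dp_tuple b) = [forall j, a j <= b j].
    by apply: eq_forallb => j; rewrite !ffunE.
  apply: (@model_embed _ _ _ _ (fun t => dp_tuple (fun j => g j t))) => t s.
  + apply/forallP/forall_inP => [H c ct|H j].
      apply/forallP => j; have := H j; rewrite !ffunE gP => /forall_inP.
      by apply.
    rewrite ffunE gP; apply/forall_inP => c /H/forallP/(_ j).
    by rewrite ffunE.
  + by move=> ts; rewrite dp_leE; apply/forallP; apply: g_mono.
  + by rewrite dp_leE => /forallP /g_refl.
have zz_bind t k :
    (existT (fun=> bool) k zz \in comps (term_bind T t)) = atom_lt (phi k) t.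
  by apply/bigcupP/atom_ltP => -[c ct ck]; exists c; rewrite // ?Tzz // -Tzz.
apply: (@model_embed _ _ _ _ (fun t => nu J (term_bind T t))) => t s.
- exact: nu_term_bind_le.
- move/satM => ts; apply/(satisfies_join hB hJ) => -[k b] /=.
  case: b => [|_]; first by rewrite !zz_bind => /ts ->.
  (* $\overline z_k$ is below the image of any [s]: each [T c] contains $z_k$ or $\overline z_k$. *)
  have [c cs] := set0Pn _ (comps_neq0 s).
  have [ck|ck] := boolP (atom_lt (phi k) (cterm c)); apply/orP; [right|left];
    by apply/bigcupP; exists c; rewrite // ?Tzz ?Tzbar.
- move/(satisfies_join hB hJ) => ts; apply/satM => k.
  by rewrite -!zz_bind => /ts; rewrite orbb.
Qed.
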